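(* Let $n<\alpha_1<\dots<\alpha_N<\alpha$ and $T>0$. Assume that the coefficients $a_k:\mathbb{Q}_p^n\times[0,T]\to\mathbb{R}$, $k=0,1,\dots,N$, are nonnegative bounded continuous functions, that $b:\mathbb{Q}_p^n\times[0,T]\to\mathbb{R}$ is a bounded continuous function, and that $0\le\lambda<\alpha_1-n$ (if $a_1=\dots=a_N\equiv0$, suppose only that $0\le\lambda<\alpha-n$). Let $u(x,t)$ be a solution, belonging to the class $\mathfrak{M}_\lambda$ (uniformly in $t$), of the homogeneous Cauchy problem $$\frac{\partial u}{\partial t}(x,t)-a_0(x,t)(\boldsymbol{W}_\alpha u)(x,t)-\sum_{k=1}^Na_k(x,t)(\boldsymbol{W}_{\alpha_k}u)(x,t)+b(x,t)u(x,t)=0,\quad x\in\mathbb{Q}_p^n,\ t\in(0,T],\qquad u(x,0)=0 .$$ Then $u(x,t)\equiv0$.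
   Context: $p$ is a prime; on $\mathbb{Q}_p^n$, $\|x\|_p=\max_i|x_i|_p$ and $d^nx$ is the Haar measure giving $\mathbb{Z}_p^n$ volume $1$. $\widetilde{\mathcal{E}}$ is the space of functions $\varphi:\mathbb{Q}_p^n\to\mathbb{C}$ for which there is $l\in\mathbb{Z}$ with $\varphi(x+x')=\varphi(x)$ for all $x$ and all $\|x'\|_p\le p^l$ (the largest such $l$ is the parameter of local constancy). For $\lambda\ge0$, $\mathfrak{M}_\lambda$ is the space of $\varphi\in\widetilde{\mathcal{E}}$ with $|\varphi(x)|\le C(1+\|x\|_p^\lambda)$ for some constant $C$. A function depending also on $t$ belongs to $\mathfrak{M}_\lambda$ uniformly with respect to $t$ if $C$ and $l$ can be chosen independent of $t$. For each exponent $\gamma\in\{\alpha_1,\dots,\alpha_N,\alpha\}$, $w_\gamma:\mathbb{Q}_p^n\to[0,\infty)$ is a fixed continuous radial function, $w_\gamma(y)=w_\gamma(\|y\|_p)$, vanishing only at $0$, with positive constants $C_0,C_1$ such that $C_0\|y\|_p^\gamma\le w_\gamma(\|y\|_p)\le C_1\|y\|_p^\gamma$ for all $y$, and $(\boldsymbol{W}_\gamma\varphi)(x)=\int_{\mathbb{Q}_p^n}\frac{\varphi(x-y)-\varphi(x)}{w_\gamma(\|y\|_p)}d^ny$, acting in the variable $x$. (When $a_1=\dots=a_N\equiv0$ the terms with $\boldsymbol{W}_{\alpha_k}$ are absent.) A solution is a function $u:\mathbb{Q}_p^n\times[0,T]\to\mathbb{C}$, continuous in $(x,t)$, with $u(\cdot,t)\in\mathfrak{M}_\lambda$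 for $t\in[0,T]$, $u(x,\cdot)$ continuously differentiable for $t\in(0,T]$, $u\in\mathfrak{M}_\lambda$ uniformly in $t$, satisfying the equation for all $t\in(0,T]$ and the initial condition. *)

(* Defs.v *)
From HB Require Import structures.
From mathcomp Require Import all_boot all_order all_algebra.
From mathcomp Require Import generic_quotient ring_quotient complex.
From mathcomp Require Import all_classical all_reals all_analysis.
Import Order.TTheory GRing.Theory Num.Theory.
Import numFieldNormedType.Exports.

Set Implicit Arguments.
Unset Strict Implicit.
Unset Printing Implicit Defensive.

Local Open Scope ring_scope.
Local Open Scope classical_set_scope.

Section PadicNormRat.
Variable p : nat.

Definition padic_val (x : rat) : int :=
  (logn p `|numq x|)%:Z - (logn p `|denq x|)%:Z.

Definition padic_norm (x : rat) : rat :=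
  if x == 0 then 0 else p%:R ^ (- padic_val x).

Hypothesis p_pr : prime p.

Lemma padic_base_gt1 : 1 < p%:R :> rat.
Proof. by rewrite ltr1n prime_gt1. Qed.

Lemma padic_base_gt0 : 0 < p%:R :> rat.
Proof. exact: lt_trans padic_base_gt1. Qed.

Lemma padic_valE (a b : int) : a != 0 -> b != 0 ->
  padic_val (a%:~R / b%:~R) = (logn p `|a|)%:Z - (logn p `|b|)%:Z.
Proof.
move=> a0 b0; set x : rat := a%:~R / b%:~R.
have x0 : x != 0 by rewrite mulf_neq0 ?invr_eq0 ?intr_eq0.
have n0 : numq x != 0 by rewrite numq_eq0.
have d0 : denq x != 0 by rewrite denq_eq0.
have e : numq x * b = a * denq x.
  apply: (@intr_inj rat); rewrite !rmorphM /= numqE mulrAC.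
  by rewrite divfK ?intr_eq0.
have {e} /(congr1 (fun m : int => (logn p `|m|%N))) := e.
rewrite !abszM !lognM ?absz_gt0 // => e.
by rewrite /padic_val; apply/eqP; rewrite subr_eq addrAC eq_sym subr_eq -!PoszD -e addnC.
Qed.

Lemma padic_valM x y : x != 0 -> y != 0 ->
  padic_val (x * y) = padic_val x + padic_val y.
Proof.
move=> x0 y0; rewrite -{1}(divq_num_den x) -{1}(divq_num_den y) mulf_div.
rewrite -!rmorphM /= padic_valE ?mulf_neq0 ?numq_eq0 ?denq_eq0 //.
rewrite !abszM !lognM ?absz_gt0 ?numq_eq0 ?denq_eq0 //.
by rewrite /padic_val !PoszD opprD addrACA.
Qed.

Lemma padic_norm0 : padic_norm 0 = 0.
Proof. by rewrite /padic_norm eqxx. Qed.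

Lemma padic_norm_gt0 x : (0 < padic_norm x) = (x != 0).
Proof.
rewrite /padic_norm; case: eqP => //= _; apply: exprz_gt0; exact: padic_base_gt0.
Qed.

Lemma padic_norm_ge0 x : 0 <= padic_norm x.
Proof.
have [->|x0] := eqVneq x 0; first by rewrite padic_norm0.
by rewrite ltW // padic_norm_gt0.
Qed.

Lemma padic_norm_eq0 x : (padic_norm x == 0) = (x == 0).
Proof.
have := padic_norm_gt0 x; rewrite lt_def padic_norm_ge0 andbT.
by move=> /(congr1 negb); rewrite !negbK.
Qed.

Lemma padic_norm1 : padic_norm 1 = 1.
Proof. by rewrite /padic_norm oner_eq0 /padic_val /= logn1. Qed.

Lemma padic_normM : {morph padic_norm : x y / x * y}.
Proof.
move=> x y; have [->|x0] := eqVneq x 0; first by rewrite mul0r padic_norm0 mul0r.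
have [->|y0] := eqVneq y 0; first by rewrite mulr0 padic_norm0 mulr0.
rewrite /padic_norm mulf_eq0 (negbTE x0) (negbTE y0) /= padic_valM // opprD.
by rewrite expfzDr // gt_eqF // padic_base_gt0.
Qed.

Lemma padic_normN x : padic_norm (- x) = padic_norm x.
Proof.
by rewrite /padic_norm oppr_eq0 /padic_val numqN denqN abszN.
Qed.

Lemma padic_normV x : padic_norm x^-1 = (padic_norm x)^-1.
Proof.
have [->|x0] := eqVneq x 0; first by rewrite !(invr0, padic_norm0).
apply: (@mulfI _ (padic_norm x)); first by rewrite padic_norm_eq0.
by rewrite -padic_normM !divff ?padic_norm1 ?padic_norm_eq0.
Qed.

Lemma padic_normD x y :
  padic_norm (x + y) <= Num.max (padic_norm x) (padic_norm y).
Proof.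
wlog yx : x y / padic_norm y <= padic_norm x => [hw|].
  have /orP[/hw //|/hw] := le_total (padic_norm y) (padic_norm x).
  by rewrite addrC maxC.
apply: (@le_trans _ _ (padic_norm x)); last by rewrite le_max lexx.
have [->|s0] := eqVneq (x + y) 0; first by rewrite padic_norm0 padic_norm_ge0.
have x0 : x != 0.
  apply: contraNneq s0 => x0; move: yx; rewrite x0 padic_norm0 add0r => yx.
  by rewrite -padic_norm_eq0 eq_le yx padic_norm_ge0.
have [->|y0] := eqVneq y 0; first by rewrite addr0.
move: yx; rewrite /padic_norm (negbTE s0) (negbTE x0) (negbTE y0).
rewrite !ler_eXz2l ?padic_base_gt1 // !lerN2.
have nz z : z != 0 -> numq z != 0 by rewrite numq_eq0.
have dz z : denq z != 0 by rewrite denq_eq0.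
have sE : x + y = (numq x * denq y + numq y * denq x)%:~R
                  / (denq x * denq y)%:~R :> rat.
  rewrite -{1}(divq_num_den x) -{1}(divq_num_den y) addf_div ?intr_eq0 //.
  by rewrite !rmorphD !rmorphM.
have m0 : numq x * denq y + numq y * denq x != 0.
  by apply: contraNneq s0 => m0; rewrite sE m0 mul0r.
move=> vxy; rewrite sE padic_valE ?mulf_neq0 // abszM lognM ?absz_gt0 // PoszD.
set m := _ + _ in m0 *.
have : (logn p `|numq x| + logn p `|denq y| <= logn p `|m|)%N.
  rewrite -pfactor_dvdn // ?absz_gt0 // -[(_ ^ _)%N]absz_nat -dvdzE.
  have le1 : (logn p `|numq x| + logn p `|denq y|
             <= logn p `|numq y| + logn p `|denq x|)%N.
    move: vxy; rewrite /padic_val -lez_nat !PoszD lerBlDr addrAC -lerBlDr opprK.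
    by [].
  by apply: rpredD; rewrite dvdzE absz_nat abszM pfactor_dvdn
    ?muln_gt0 ?absz_gt0 ?nz ?dz // lognM ?absz_gt0 ?nz ?dz.
rewrite -lez_nat PoszD /padic_val => h.
by rewrite opprD addrCA [_ - _]addrC lerD2l lerBrDr.
Qed.

End PadicNormRat.

Section PadicNumbers.
Variables (p : nat) (p_pr : prime p).
Local Notation "`| x |_p" := (padic_norm p x) (format "`| x |_p").

(* Q_p is the completion of Q for the p-adic norm: Cauchy sequences modulo null
   sequences. The primality proof is a phantom parameter of the predicates
   below, from which the instances recover it. *)
Definition padic_cauchy of prime p : {pred nat -> rat} := fun u =>
  `[< forall e : rat, 0 < e -> exists N : nat, forall i j : nat,
        (N <= i)%N -> (N <= j)%N -> `|u i - u j|_p < e >].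

Lemma padic_cauchy_bound (u : nat -> rat) : u \in padic_cauchy p_pr ->
  exists2 M : rat, 0 < M & exists N : nat, forall i, (N <= i)%N -> `|u i|_p <= M.
Proof.
move=> /asboolP /(_ 1 ltr01)[N uN].
exists (Num.max 1 `|u N|_p); first by rewrite lt_max ltr01.
exists N => i Ni; rewrite -[u i](subrK (u N)).
apply: le_trans (padic_normD p_pr _ _) _.
by rewrite ge_max !le_max lexx orbT andbT ltW ?uN.
Qed.

Lemma padic_cauchy_subring : subring_closed (padic_cauchy p_pr).
Proof.
split=> [|u v /asboolP cu /asboolP cv|u v cu cv].
- by apply/asboolP => e e0; exists 0%N => i j _ _; rewrite subrr padic_norm0.
- apply/asboolP => e e0; have [N uN] := cu e e0; have [M vM] := cv e e0.
  exists (maxn N M) => i j; rewrite !geq_max => /andP[Ni Mi] /andP[Nj Mj].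
  rewrite opprD addrACA -opprD; apply: le_lt_trans (padic_normD p_pr _ _) _.
  by rewrite padic_normN gt_max uN ?vM.
have [A A0 [N1 uA]] := padic_cauchy_bound cu.
have [B B0 [N2 vB]] := padic_cauchy_bound cv.
move: cu cv => /asboolP cu /asboolP cv; apply/asboolP => e e0.
have [N3 uN] := cu (e / B) (divr_gt0 e0 B0).
have [N4 vN] := cv (e / A) (divr_gt0 e0 A0).
exists (maxn (maxn N1 N2) (maxn N3 N4)) => i j.
rewrite !geq_max => /andP[/andP[i1 i2] /andP[i3 i4]] /andP[/andP[j1 j2] /andP[j3 j4]].
have -> : (u * v) i - (u * v) j = u i * (v i - v j) + (u i - u j) * v j.
  by rewrite mulrBr mulrBl addrA subrK.
apply: le_lt_trans (padic_normD p_pr _ _) _; rewrite !padic_normM // gt_max.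
apply/andP; split.
  apply: (@le_lt_trans _ _ (A * `|v i - v j|_p)).
    by rewrite ler_wpM2r ?padic_norm_ge0 // uA.
  by rewrite mulrC -ltr_pdivlMr // vN.
apply: (@le_lt_trans _ _ (`|u i - u j|_p * B)).
  by rewrite ler_wpM2l ?padic_norm_ge0 // vB.
by rewrite -ltr_pdivlMr // uN.
Qed.

HB.instance Definition _ :=
  GRing.isSubringClosed.Build (nat -> rat) (padic_cauchy p_pr) padic_cauchy_subring.

Record padic_seq := PadicSeq {
  padic_seq_val :> nat -> rat;
  _ : padic_cauchy p_pr padic_seq_val }.

HB.instance Definition _ := [isSub for padic_seq_val].
HB.instance Definition _ := [Choice of padic_seq by <:].
HB.instance Definition _ := [SubChoice_isSubComNzRing of padic_seq by <:].

Definition padic_null : {pred padic_seq} := fun u =>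
  `[< forall e : rat, 0 < e -> exists N : nat, forall i : nat,
        (N <= i)%N -> `|u i|_p < e >].

Lemma padic_null_ideal : idealr_closed padic_null.
Proof.
split.
- by apply/asboolP => e e0; exists 0%N => i _; rewrite padic_norm0.
- apply/negP => /asboolP /(_ 1 ltr01)[N /(_ N (leqnn N))].
  by rewrite padic_norm1 ltxx.
- move=> a u v /asboolP nu /asboolP nv; apply/asboolP => e e0.
  have [A A0 [N1 aA]] := padic_cauchy_bound (valP a).
  have [N2 uN] := nu (e / A) (divr_gt0 e0 A0).
  have [N3 vN] := nv e e0.
  exists (maxn N1 (maxn N2 N3)) => i; rewrite !geq_max => /and3P[i1 i2 i3].
  apply: le_lt_trans (padic_normD p_pr _ _) _; rewrite gt_max vN // andbT.
  rewrite padic_normM //; apply: (@le_lt_trans _ _ (A * `|u i|_p)).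
    by rewrite ler_wpM2r ?padic_norm_ge0 // aA.
  by rewrite mulrC -ltr_pdivlMr // uN.
Qed.

HB.instance Definition _ := isIdealr.Build padic_seq padic_null padic_null_ideal.

Definition Qp := {ideal_quot padic_null}.

HB.instance Definition _ := GRing.ComNzRing.on Qp.

Lemma padic_norm_isosceles x y : `|x - y|_p < `|y|_p -> `|x|_p = `|y|_p.
Proof.
move=> xy; apply/eqP; rewrite eq_le; apply/andP; split.
  rewrite -{1}(subrK y x); apply: le_trans (padic_normD p_pr _ _) _.
  by rewrite ge_max lexx andbT ltW.
rewrite leNgt; apply/negP => yx.
have := padic_normD p_pr x (y - x); rewrite subrKC leNgt gt_max yx /=.
by rewrite -opprB padic_normN xy.
Qed.

Lemma padic_seq_stable (u : padic_seq) : u \notin padic_null ->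
  exists c : rat, 0 < c /\ exists N : nat, forall i, (N <= i)%N -> `|u i|_p = c.
Proof.
move=> /negP nu; case: (pselect (exists2 e : rat, 0 < e &
  forall N, exists2 i : nat, (N <= i)%N & e <= `|u i|_p)); last first.
  move=> h; exfalso; apply: nu; apply/asboolP => e e0.
  apply: contrapT => hN; apply: h; exists e => // N.
  apply: contrapT => hi; apply: hN; exists N => i Ni.
  by rewrite ltNge; apply/negP => ei; apply: hi; exists i.
move=> [e e0 he]; have /asboolP /(_ e e0)[N uN] := valP u.
have [i0 Ni0 ei0] := he N.
exists (`|u i0|_p); split; first exact: lt_le_trans ei0.
exists N => i Ni; apply: padic_norm_isosceles.
exact: lt_le_trans (uN _ _ Ni Ni0) ei0.
Qed.

Lemma Qp_eq0E (u : padic_seq) : (\pi_(Qp)%qT u == 0) = (u \in padic_null).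
Proof.
by rewrite -[0](rmorph0 (\pi_Qp)%qT) -Quotient.idealrBE subr0.
Qed.

Definition Qp_inv (x : Qp) : Qp := xget 0 [set y : Qp | y * x = 1].

Lemma Qp_mulVf x : x != 0 -> Qp_inv x * x = 1.
Proof.
rewrite -[x]reprK Qp_eq0E; set u := repr x => nu.
apply: (@xgetPex _ (0 : Qp) [set y : Qp | y * (\pi_Qp)%qT u = 1]).
have [c [c0 [N uN]]] := padic_seq_stable nu.
have u0 i : (N <= i)%N -> u i != 0 by move=> /uN ui; rewrite -(padic_norm_gt0 p_pr) ui.
have cv : padic_cauchy p_pr (fun i => (u i)^-1).
  apply/asboolP => e e0.
  have /asboolP /(_ (e * (c * c)))[|N1 uN1] := valP u; first by rewrite !mulr_gt0.
  exists (maxn N N1) => i j; rewrite !geq_max => /andP[i0 i1] /andP[j0 j1].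
  have -> : (u i)^-1 - (u j)^-1 = (u j - u i) / (u i * u j).
    by rewrite mulrBl invfM mulVKf ?u0 // mulrCA divff ?u0 // mulr1.
  rewrite padic_normM // padic_normV // padic_normM // !uN //.
  by rewrite ltr_pdivrMr ?mulr_gt0 // uN1.
exists ((\pi_Qp)%qT (PadicSeq cv)) => /=.
rewrite -rmorphM -(rmorph1 (\pi_Qp)%qT); apply/eqP; rewrite -Quotient.idealrBE.
apply/asboolP => e e0; exists N => i Ni.
rewrite (_ : padic_seq_val _ i = (u i)^-1 * u i - 1) //.
by rewrite mulVf ?u0 // subrr padic_norm0.
Qed.

Lemma Qp_inv0 : Qp_inv 0 = 0.
Proof.
rewrite /Qp_inv; case: xgetP => // y _ /= /eqP.
by rewrite mulr0 eq_sym oner_eq0.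
Qed.

HB.instance Definition _ := GRing.ComNzRing_isField.Build Qp Qp_mulVf Qp_inv0.

(* The sequence of norms is stationary or tends to 0, so it converges in Q. *)
Definition Qp_norm (x : Qp) : rat :=
  lim ((fun i => `|repr x i|_p : rat^o) @ \oo).

Lemma Qp_norm_cvg (u : padic_seq) :
  (fun i => `|u i|_p : rat^o) @ \oo --> (Qp_norm ((\pi_Qp)%qT u) : rat^o).
Proof.
set w := repr ((\pi_Qp)%qT u).
have nuw : u - w \in padic_null.
  by rewrite Quotient.idealrBE reprK.
case: (boolP (u \in padic_null)) => nu.
  have nw : w \in padic_null by rewrite -[w](subKr u) rpredB.
  have cvg0 (v : padic_seq) : v \in padic_null ->
      (fun i => `|v i|_p : rat^o) @ \oo --> (0 : rat^o).
    move=> /asboolP nv; apply/cvgrPdist_lt => e e0; have [N vN] := nv e e0.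
    exists N => // i /= Ni.
    by rewrite sub0r normrN ger0_norm ?padic_norm_ge0 // vN.
  by rewrite /Qp_norm -/w (cvg_lim _ (cvg0 _ nw)) //; exact: cvg0.
have [c [c0 [N uN]]] := padic_seq_stable nu.
have /asboolP /(_ c c0)[N1 uwN] := nuw.
have cvgc (v : padic_seq) : (forall i, (maxn N N1 <= i)%N -> `|v i|_p = c) ->
    (fun i => `|v i|_p : rat^o) @ \oo --> (c : rat^o).
  by move=> vc; apply: cvg_near_cst; exists (maxn N N1).
have cw : (fun i => `|w i|_p : rat^o) @ \oo --> (c : rat^o).
  apply: cvgc => i; rewrite geq_max => /andP[Ni Ni1].
  rewrite -(uN i Ni); apply: padic_norm_isosceles.
  by rewrite uN // -opprB padic_normN; apply: uwN.
rewrite /Qp_norm -/w (cvg_lim _ cw) //; apply: cvgc => i.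
by rewrite geq_max => /andP[Ni _]; rewrite uN.
Qed.

Lemma Qp_normE (u : padic_seq) (c : rat) :
  (fun i => `|u i|_p : rat^o) @ \oo --> (c : rat^o) ->
  Qp_norm ((\pi_Qp)%qT u) = c.
Proof. by move=> uc; rewrite -(cvg_lim _ (@Qp_norm_cvg u)) // (cvg_lim _ uc). Qed.

Lemma Qp_norm_ge0 x : 0 <= Qp_norm x.
Proof.
rewrite -[x]reprK; apply: (cvgr_to_ge (@Qp_norm_cvg _)).
by apply: nearW => i; exact: padic_norm_ge0.
Qed.

Lemma Qp_norm_eq0 x : (Qp_norm x == 0) = (x == 0).
Proof.
rewrite -[x]reprK Qp_eq0E; set u := repr x; apply/idP/idP => [/eqP u0|nu].
  apply/negPn/negP => nu; have [c [c0 [N uN]]] := padic_seq_stable nu.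
  suff : Qp_norm ((\pi_Qp)%qT u) = c by move=> uc; rewrite -uc u0 ltxx in c0.
  by apply: Qp_normE; apply: cvg_near_cst; exists N => // i /= /uN.
apply/eqP/Qp_normE/cvgrPdist_lt => e e0.
have /asboolP /(_ e e0)[N uN] := nu; exists N => // i /= Ni.
by rewrite sub0r normrN ger0_norm ?padic_norm_ge0 // uN.
Qed.

Lemma Qp_normN x : Qp_norm (- x) = Qp_norm x.
Proof.
rewrite -[x]reprK -rmorphN; apply: Qp_normE.
under eq_fun do rewrite [padic_seq_val _ _]/= padic_normN.
exact: Qp_norm_cvg.
Qed.

Lemma Qp_normD x y : Qp_norm (x + y) <= Num.max (Qp_norm x) (Qp_norm y).
Proof.
apply/ler_addgt0Pr => e e0; set M := Num.max _ _.
have Mlt z : Qp_norm z <= M -> \forall i \near \oo, `|repr z i|_p < M + e.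
  rewrite -{1}[z]reprK => zM.
  by apply: (cvgr_lt _ (@Qp_norm_cvg _)); rewrite (le_lt_trans zM) // ltrDl.
rewrite -[x]reprK -[y]reprK -rmorphD; apply: (cvgr_to_le (@Qp_norm_cvg _)).
have [xM yM] : Qp_norm x <= M /\ Qp_norm y <= M by rewrite !le_max !lexx orbT.
apply: filterS2 (Mlt x xM) (Mlt y yM) => i xi yi.
by apply: le_trans (padic_normD p_pr _ _) _; rewrite ge_max !ltW.
Qed.

Definition Qp_ball (x : Qp) (e : rat) (y : Qp) : Prop := Qp_norm (x - y) < e.

Lemma Qp_ball_center x e : 0 < e -> Qp_ball x e x.
Proof.
have /eqP := Qp_norm_eq0 0; rewrite eqxx => /eqP/eqP n0.
by rewrite /Qp_ball subrr n0.
Qed.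

Lemma Qp_ball_sym x y e : Qp_ball x e y -> Qp_ball y e x.
Proof. by rewrite /Qp_ball -opprB Qp_normN. Qed.

Lemma Qp_ball_triangle x y z e1 e2 :
  Qp_ball x e1 y -> Qp_ball y e2 z -> Qp_ball x (e1 + e2) z.
Proof.
rewrite /Qp_ball => xy yz; rewrite -(subrK y x) -addrA.
apply: le_lt_trans (Qp_normD _ _) _; rewrite gt_max.
have e10 := le_lt_trans (Qp_norm_ge0 _) xy.
have e20 := le_lt_trans (Qp_norm_ge0 _) yz.
by rewrite (lt_trans xy) ?(lt_trans yz) ?ltrDl ?ltrDr.
Qed.

(* The norm takes rational values, so Q_p is a pseudometric space over [rat];
   its topology thus does not involve any choice of a [realType]. *)
HB.instance Definition _ := isPointed.Build Qp 0.
HB.instance Definition _ := hasNbhs.Build Qp (nbhs_ (entourage_ Qp_ball)).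
HB.instance Definition _ := Nbhs_isPseudoMetric.Build rat Qp
  erefl Qp_ball_center Qp_ball_sym Qp_ball_triangle erefl.

End PadicNumbers.

Section Analysis.
Local Open Scope complex_scope.
Variables (p : nat) (p_pr : prime p) (R : realType) (n : nat).
Local Notation Qpn := 'rV[Qp p_pr]_n.

Definition Qpn_norm (x : Qpn) : R := \big[Num.max/0]_(i < n) ratr (Qp_norm (x 0 i)).

Definition borelQpn := g_sigma_algebraType (@open Qpn).

(* By uniqueness of Haar measure these two conditions determine [mu]; the unit
   ball is Z_p^n. *)
Definition is_haar (mu : {measure set borelQpn -> \bar R}) : Prop :=
  (forall (x : Qpn) (A : set borelQpn), measurable A ->
     mu [set x + (y : Qpn) | y in A] = mu A) /\
  mu [set x | Qpn_norm x <= 1] = 1%E.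

(* Integral of a complex-valued function, componentwise; junk value when the
   integrand is not integrable. *)
Definition cintegral (mu : {measure set borelQpn -> \bar R}) (f : Qpn -> R[i]) : R[i] :=
  Rintegral mu setT (fun y => complex.Re (f y)) +i*
  Rintegral mu setT (fun y => complex.Im (f y)).

Record is_weight (gamma : R) (w : Qpn -> R) : Prop := {
  weight_continuous : continuous w;
  weight_ge0 : forall y, 0 <= w y;
  weight_radial : forall y z, Qpn_norm y = Qpn_norm z -> w y = w z;
  weight_eq0 : forall y, w y = 0 <-> y = 0;
  weight_bounds : exists C0 C1 : R, [/\ 0 < C0, 0 < C1 &
    forall y, C0 * Qpn_norm y `^ gamma <= w y <= C1 * Qpn_norm y `^ gamma] }.

(* At [y = 0] the integrand is [0 / 0 = 0]. *)
Definition opW (mu : {measure set borelQpn -> \bar R}) (w : Qpn -> R)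
    (phi : Qpn -> R[i]) (x : Qpn) : R[i] :=
  cintegral mu (fun y => (phi (x - y) - phi x) / (w y)%:C).

Definition locally_constant_with (l : int) (phi : Qpn -> R[i]) : Prop :=
  forall x x', Qpn_norm x' <= p%:R ^ l -> phi (x + x') = phi x.

Definition growth_with (lam C : R) (phi : Qpn -> R[i]) : Prop :=
  forall x, `|phi x| <= (C * (1 + Qpn_norm x `^ lam))%:C.

Definition tildeE (phi : Qpn -> R[i]) : Prop :=
  exists l, locally_constant_with l phi.

Definition classM (lam : R) (phi : Qpn -> R[i]) : Prop :=
  tildeE phi /\ exists C, growth_with lam C phi.

Definition classM_unif (lam T : R) (u : Qpn -> R -> R[i]) : Prop :=
  exists C l, forall t, 0 <= t <= T ->
    locally_constant_with l (u^~ t) /\ growth_with lam C (u^~ t).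

Definition continuous_on_strip (V : topologicalType) (T : R)
    (f : Qpn -> R -> V) : Prop :=
  {within [set: Qpn] `*` `[0, T], continuous (fun z : Qpn * R => f z.1 z.2)}.

Definition bounded_on_strip (T : R) (f : Qpn -> R -> R) : Prop :=
  exists M, forall x t, 0 <= t <= T -> `|f x t| <= M.

(* Derivative at [t] of a function on [0, T], hence one-sided at [T]. *)
Definition has_tderiv (T : R) (f : R -> R[i]) (t : R) (d : R[i]) : Prop :=
  ((f s - f t) / (s - t)%:C : R[i]^o) @[s --> within `[0, T] t^'] --> (d : R[i]^o).

(* The exponents alpha_1, .., alpha_N are [al 1], .., [al N], and [w gamma] is
   the weight attached to the exponent [gamma]. *)
Record homogeneous_solution (mu : {measure set borelQpn -> \bar R})
    (w : R -> Qpn -> R) (N : nat) (alpha : R) (al : nat -> R)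
    (a : nat -> Qpn -> R -> R) (b : Qpn -> R -> R) (lam T : R)
    (u : Qpn -> R -> R[i]) : Prop := {
  sol_continuous : continuous_on_strip T (u : Qpn -> R -> R[i]^o);
  sol_classM : forall t, 0 <= t <= T -> classM lam (u^~ t);
  sol_classM_unif : classM_unif lam T u;
  sol_equation : exists du : Qpn -> R -> R[i],
    [/\ forall x, {within `]0, T], continuous (du x : R -> R[i]^o)},
        forall x t, 0 < t <= T -> has_tderiv T (u x) t (du x t) &
        forall x t, 0 < t <= T ->
          du x t - (a 0%N x t)%:C * opW mu (w alpha) (u^~ t) x
          - \sum_(1 <= k < N.+1) (a k x t)%:C * opW mu (w (al k)) (u^~ t) x
          + (b x t)%:C * u x t = 0];
  sol_initial : forall x, u x 0 = 0 }.

End Analysis.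

(* Main.v *)
Require Import Defs.
From HB Require Import structures.
From mathcomp Require Import all_boot all_order all_algebra.
From mathcomp Require Import complex.
From mathcomp Require Import ring lra.
From mathcomp Require Import all_classical all_reals all_analysis measurable_realfun.
Import Order.TTheory GRing.Theory Num.Theory.
Import numFieldNormedType.Exports.

Local Open Scope ring_scope.
Local Open Scope classical_set_scope.

(** A solution [u] is constant in [x] on balls of one fixed radius [p ^ l], for
    all times at once. For such functions the singularity of [1 / w_gamma] at the
    origin is invisible: the difference [phi (x - y) - phi x] vanishes when
    [norm y <= p ^ l], and only the integrable tail of the kernel remains. Hence
    [W_gamma] acts as a bounded operator on these functions for the weighted sup
    norm with weight [g x = 1 + norm x ^ lam]: the ultrametric inequality gives
    [norm (x - y) ^ lam <= norm x ^ lam + norm y ^ lam], and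
    [norm y ^ (lam - gamma)] is integrable on [norm y > p ^ l] because
    [lam < gamma - n] ([real_opW_bounded]). The Cauchy problem is thus a linear
    ordinary differential equation with bounded coefficients in a weighted sup
    norm, and uniqueness is a Gronwall argument.

    Integrability of the tail follows from [mu {norm y <= p ^ k} <= p ^ (k n)]
    ([haar_cball_le]), which holds because [p ^ -k Z_p] is covered by [p ^ k]
    translates of [Z_p] ([Qp_coset_rep]), and from a geometric series
    ([norm_Rintegral_tail_le]).

    For the Gronwall argument ([weighted_gronwall]), if
    [|v x t| <= A * g x * exp (2 K t)] and the equation bounds the time derivative
    by [K] times the same quantity, then integrating in time yields the bound with
    [A / 2] instead of [A]; starting from the growth bound of the solution and
    iterating forces [v = 0].

    The coefficients are real, so the real and imaginary parts of [u] solve the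
    same equation; both are treated at once through the properties they share
    ([real_component]). *)

Set Implicit Arguments.
Unset Strict Implicit.
Unset Printing Implicit Defensive.

(** * Cosets of Z_p in p^-k Z_p *)

Section PadicCosets.
Variables (p : nat) (p_pr : prime p).

Lemma padic_norm_intE (m : int) : m != 0 ->
  padic_norm p m%:~R = p%:R ^ (- (logn p `|m|)%:Z).
Proof.
move=> m0; rewrite /padic_norm intr_eq0 (negbTE m0).
by rewrite /padic_val numq_int denq_int /= logn1 subr0.
Qed.

Lemma padic_norm_dvd (m : int) k : ((p ^ k)%N %| m)%Z ->
  padic_norm p m%:~R <= p%:R ^ (- k%:Z).
Proof.
have [-> _|m0] := eqVneq m 0.
  by rewrite padic_norm0 exprz_ge0.
rewrite dvdzE absz_nat pfactor_dvdn ?absz_gt0 // => km.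
by rewrite padic_norm_intE // ler_eXz2l ?padic_base_gt1 // lerN2 lez_nat.
Qed.

Lemma padic_normX (k : int) : padic_norm p (p%:R ^ k) = p%:R ^ (- k).
Proof.
have p0 : (0 < p)%N by exact: prime_gt0.
have nat_case (j : nat) : padic_norm p (p%:R ^+ j) = p%:R ^ (- j%:Z).
  rewrite -natrX (pmulrn _ (p ^ j)) padic_norm_intE ?absz_nat ?pfactorK //.
  by rewrite eqz_nat -lt0n expn_gt0 p0.
case: k => j; first exact: nat_case.
by rewrite NegzE opprK -exprnN padic_normV // nat_case invr_expz opprK.
Qed.

(** After multiplication by [p ^ k] one looks for an integer congruent to a
    fraction [r] modulo [p ^ k]. Since [|r|_p <= 1] the denominator of [r] is a
    unit modulo [p ^ k], and a Bezout relation inverts it. *)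
Lemma rat_coset_rep (q : rat) k : padic_norm p q <= p%:R ^+ k ->
  exists2 m, (m < p ^ k)%N & padic_norm p (q - m%:R / p%:R ^+ k) <= 1.
Proof.
move=> qk; have pk0 : p%:R ^+ k != 0 :> rat.
  by rewrite expf_eq0 pnatr_eq0 (gtn_eqF (prime_gt0 p_pr)) andbF.
set r := q * p%:R ^+ k.
have r1 : padic_norm p r <= 1.
  rewrite padic_normM // (padic_normX k) -exprnN.
  by rewrite ler_pdivrMr ?mul1r // exprn_gt0 // padic_base_gt0.
have pb : ~~ (p %| `|denq r|)%N.
  have [r0|r0] := eqVneq r 0; first by rewrite r0 /= Euclid_dvd1.
  apply/negP => pd; move: r1; rewrite /padic_norm (negbTE r0).
  rewrite -[leRHS](expr0z (p%:R : rat)) ler_eXz2l ?padic_base_gt1 //.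
  have pn : ~~ (p %| `|numq r|)%N.
    apply/negP => pn; have := coprime_num_den r; rewrite /coprime => /eqP g1.
    have : (p %| gcdn `|numq r| `|denq r|)%N by rewrite dvdn_gcd pn.
    by rewrite g1 Euclid_dvd1.
  rewrite /padic_val lognE p_pr absz_gt0 numq_eq0 r0 (negbTE pn) /=.
  rewrite add0r opprK lez_nat leqn0 => /eqP ld.
  have : (0 < logn p `|denq r|)%N by rewrite logn_gt0 mem_primes p_pr absz_gt0 denq_eq0.
  by rewrite ld.
have cop : coprimez (denq r) (p ^ k)%N.
  by rewrite coprimezE absz_nat coprime_sym coprimeXl // prime_coprime.
have [x [y xy]] := Bezoutz (denq r) (p ^ k)%N.
rewrite (eqP cop) in xy.
have Pk0 : (p ^ k)%N%:Z != 0 by rewrite eqz_nat -lt0n expn_gt0 prime_gt0.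
(* [x] inverts [denq r] modulo [p ^ k], so [z] is congruent to [r]. *)
set z := ((numq r * x) %% (p ^ k)%N)%Z.
have z0 : 0 <= z by exact: modz_ge0.
exists `|z|%N.
  by rewrite -ltz_nat gez0_abs // ltz_mod.
have zE : (`|z|%N%:R : rat) = z%:~R by rewrite -{2}(gez0_abs z0).
have -> : q - `|z|%N%:R / p%:R ^+ k = (r - z%:~R) / p%:R ^+ k.
  by rewrite zE mulrBl mulfK.
rewrite padic_normM // padic_normV // (padic_normX k).
rewrite invr_expz opprK.
rewrite -ler_pdivlMr ?exprz_gt0 ?padic_base_gt0 // mul1r invr_expz.
have -> : r - z%:~R = (numq r - z * denq r)%:~R / (denq r)%:~R.
  by rewrite intrB intrM mulrBl divq_num_den mulfK // intr_eq0 denq_eq0.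
rewrite padic_normM // padic_normV //.
have -> : padic_norm p (denq r)%:~R = 1.
  rewrite /padic_norm intr_eq0 denq_eq0 /padic_val numq_int denq_int /= logn1.
  by rewrite subr0 lognE (negbTE pb) !andbF.
rewrite invr1 mulr1; apply: padic_norm_dvd.
have -> : numq r - z * denq r =
    numq r * y * (p ^ k)%N + (numq r * x - z) * denq r.
  by rewrite -[X in X - _ = _]mulr1 -xy; ring.
rewrite [X in X - z](divz_eq _ (p ^ k)%N) addrK.
by apply: rpredD; [|rewrite mulrAC]; exact: dvdz_mull.
Qed.

Lemma const_cauchy (q : rat) : padic_cauchy p_pr (fun=> q).
Proof.
by apply/asboolP => e e0; exists 0%N => i j _ _; rewrite subrr padic_norm0.
Qed.

Definition rat_to_Qp (q : rat) : Qp p_pr :=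
  (\pi_(Qp p_pr)%qT (PadicSeq (const_cauchy q))).

(** Density of the rationals, in the form used to transfer [rat_coset_rep]: some
    [q] lies within distance 1 of [x], so up to an error 1 it can replace [x] in
    the distance to any other rational. *)
Lemma Qp_norm_near_rat (x : Qp p_pr) : exists q, forall c,
   Qp_norm (x - rat_to_Qp c) <= Num.max 1 (padic_norm p (q - c)).
Proof.
rewrite -[x]reprK; set u := repr x.
have /asboolP /(_ 1 ltr01)[N uN] := valP u.
exists (u N) => c; rewrite -rmorphB /=.
apply: (cvgr_to_le (@Qp_norm_cvg _ p_pr _)); exists N => // i /= Ni.
suff : padic_norm p ((u i - u N) + (u N - c)) <= Num.max 1 (padic_norm p (u N - c)).
  by rewrite addrA subrK.
apply: le_trans (padic_normD p_pr _ _) _; rewrite ge_max !le_max lexx orbT.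
by rewrite ltW // uN.
Qed.

Lemma Qp_norm_rat c : Qp_norm (rat_to_Qp c) = padic_norm p c.
Proof. by apply: Qp_normE; apply: cvg_near_cst; exists 0%N. Qed.

Lemma Qp_coset_rep (x : Qp p_pr) k : Qp_norm x <= p%:R ^+ k ->
  exists2 m, (m < p ^ k)%N &
    Qp_norm (x - rat_to_Qp (m%:R / p%:R ^+ k)) <= 1.
Proof.
move=> xk; have [q qx] := Qp_norm_near_rat x.
have pk1 : 1 <= p%:R ^+ k :> rat by rewrite exprn_ege1 // ltW // padic_base_gt1.
have qk : padic_norm p q <= p%:R ^+ k.
  rewrite -Qp_norm_rat -[rat_to_Qp q](subKr x).
  apply: le_trans (Qp_normD _ _) _; rewrite ge_max xk Qp_normN.
  apply: le_trans (qx q) _; rewrite subrr padic_norm0 ge_max pk1.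
  exact: le_trans pk1.
have [m mk qm] := rat_coset_rep qk; exists m => //.
by apply: le_trans (qx _) _; rewrite ge_max lexx.
Qed.

End PadicCosets.

(** * Haar measure of balls *)

Section HaarBalls.
Variables (p : nat) (p_pr : prime p) (R : realType) (n : nat).
Local Notation Qpn := 'rV[Qp p_pr]_n.
Local Notation norm := (@Qpn_norm p p_pr R n).

Lemma Qpn_norm_leP (x : Qpn) (c : R) : 0 <= c ->
  reflect (forall i, ratr (Qp_norm (x 0 i)) <= c) (norm x <= c).
Proof.
move=> c0; apply: (iffP (bigmax_leP _ _ _ _)) => [[_ h] i|h]; first exact: h.
by split.
Qed.

Lemma Qpn_norm_ge0 (x : Qpn) : 0 <= norm x.
Proof. exact: bigmax_ge_id. Qed.

Lemma Qp_norm_le_Qpn_norm (x : Qpn) i : ratr (Qp_norm (x 0 i)) <= norm x.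
Proof. exact: (Qpn_norm_leP _ (Qpn_norm_ge0 x) _). Qed.

Lemma Qpn_normN (x : Qpn) : norm (- x) = norm x.
Proof. by apply: eq_bigr => i _; rewrite mxE Qp_normN. Qed.

Lemma Qpn_normD (x y : Qpn) : norm (x + y) <= Num.max (norm x) (norm y).
Proof.
apply/Qpn_norm_leP => [|i]; first by rewrite le_max Qpn_norm_ge0.
rewrite mxE.
have : ratr (Qp_norm (x 0 i + y 0 i)) <=
    Num.max (ratr (Qp_norm (x 0 i))) (ratr (Qp_norm (y 0 i))) :> R.
  by rewrite le_max !ler_rat -le_max Qp_normD.
move/le_trans; apply; rewrite ge_max !le_max.
by rewrite !Qp_norm_le_Qpn_norm orbT.
Qed.

Definition Qpn_cball (v : Qpn) (c : R) : set Qpn := [set y | norm (y - v) <= c].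

(** By the ultrametric inequality a point of the ball may be moved by any vector
    of norm at most [1 <= c] without leaving it. *)
Lemma open_Qpn_cball v c : 1 <= c -> open (Qpn_cball v c).
Proof.
move=> c1; rewrite openE => y yc; exists (fun i j => Qp_ball (y i j) 1).
  by move=> i j; exact: nbhsx_ballx.
move=> z yz; have zE : z - v = (z - y) + (y - v) by rewrite addrA subrK.
suff zyc : norm (z - y) <= c.
  have := Qpn_normD (z - y) (y - v); rewrite -zE => zyv.
  apply: (le_trans zyv); rewrite ge_max; apply/andP; split; first exact: zyc.
  exact: yc.
apply/Qpn_norm_leP => [|i]; first exact: le_trans c1.
apply: le_trans c1; rewrite !mxE.
have := yz 0 i; rewrite /Qp_ball -opprB Qp_normN => /ltW.
by rewrite -(ler_rat R) rmorph1.
Qed.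

Lemma measurable_Qpn_cball v c : 1 <= c ->
  measurable (Qpn_cball v c : set (borelQpn p_pr n)).
Proof. by move=> c1; apply: sub_sigma_algebra; exact: open_Qpn_cball. Qed.

(** The index [f] lists, coordinate by coordinate, the numerator of the coset
    representative with denominator [p ^ k]. *)
Lemma Qpn_cball_translates k : Qpn_cball 0 (p%:R ^+ k) `<=`
  \bigcup_(f in [set` enum {ffun 'I_n -> 'I_(p ^ k)}])
    Qpn_cball (\row_i rat_to_Qp p_pr ((f i)%:R / p%:R ^+ k)) 1.
Proof.
move=> x; rewrite /Qpn_cball /= subr0.
move=> /(Qpn_norm_leP _ (exprn_ge0 _ (ler0n _ _))) xk.
have hm i : exists m : 'I_(p ^ k),
    Qp_norm (x 0 i - rat_to_Qp p_pr (m%:R / p%:R ^+ k)) <= 1.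
  have xi : Qp_norm (x 0 i) <= p%:R ^+ k.
    by rewrite -(ler_rat R) rmorphXn /= ratr_nat.
  by have [m mk xm] := Qp_coset_rep xi; exists (Ordinal mk).
have [f fx] := choice hm; exists (finfun f); first by rewrite /= mem_enum.
apply/Qpn_norm_leP => // i; rewrite !mxE ffunE.
by have := fx i; rewrite -(ler_rat R) rmorph1.
Qed.

Variable mu : {measure set (borelQpn p_pr n) -> \bar R}.
Hypothesis haar_mu : is_haar mu.

Lemma haar_unit_cball v : mu (Qpn_cball v 1) = 1%E.
Proof.
have [tr unit] := haar_mu.
have -> : Qpn_cball v 1 = [set v + (y : Qpn) | y in Qpn_cball 0 1].
  apply/seteqP; split=> [y yv|_ [y yv <-]].
    exists (y - v); first by rewrite /Qpn_cball /= subr0.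
    by rewrite addrC subrK.
  by move: yv; rewrite /Qpn_cball /= subr0 addrC addKr.
rewrite tr; last exact: measurable_Qpn_cball.
by rewrite -unit; congr (mu _); apply/seteqP; split=> y; rewrite /Qpn_cball /= subr0.
Qed.

(** The ball is covered by [(p ^ k) ^ n] translates of the unit ball. *)
Lemma haar_cball_le k :
  (mu (Qpn_cball 0 (p%:R ^+ k)) <= (p%:R ^+ (k * n))%:E)%E.
Proof.
have pk1 : 1 <= p%:R ^+ k :> R.
  by rewrite exprn_ege1 // ler1n prime_gt0.
apply: (@le_trans _ _ (\sum_(f \in [set` enum {ffun 'I_n -> 'I_(p ^ k)}])
    mu (Qpn_cball (\row_i rat_to_Qp p_pr ((f i)%:R / p%:R ^+ k)) 1))%E).
  apply: content_sub_fsum; last exact: Qpn_cball_translates.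
  - exact: finite_seq.
  - by move=> f _; exact: measurable_Qpn_cball.
  - exact: measurable_Qpn_cball.
under eq_fsbigr do rewrite haar_unit_cball.
rewrite -fsbig_seq ?enum_uniq // big_enum /= sumEFin lee_fin sumr_const card_ffun !card_ord.
by rewrite -expnM natrX.
Qed.

End HaarBalls.

(** * Integrals over the complement of a ball *)

Section IntegralBounds.
Local Open Scope ereal_scope.
Context d (T : measurableType d) (R : realType).
Variable mu : {measure set T -> \bar R}.

(** The integral of a nonnegative function is a supremum over the simple
    functions below it, hence monotone on arbitrary nonnegative functions. *)
Lemma ge0_le_integral_any (f g : T -> \bar R) :
  (forall x, 0 <= f x) -> (forall x, f x <= g x) ->
  \int[mu]_x f x <= \int[mu]_x g x.
Proof.
move=> f0 fg; have g0 x : 0 <= g x by exact: le_trans (fg x).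
rewrite !ge0_integralTE //; apply: le_ereal_sup => _ [h /= hf <-].
by exists h => // x; exact: le_trans (fg x).
Qed.

(** The positive and negative parts of [f] both have integral between 0 and [I];
    the integral of [f] is their difference. *)
Lemma norm_Rintegral_le (f : T -> R) (g : T -> \bar R) (I : R) :
  (forall x, `|f x|%:E <= g x) -> \int[mu]_x g x <= I%:E ->
  (`|Rintegral mu setT f| <= I)%R.
Proof.
move=> fg gI; rewrite /Rintegral integralE.
have bnd (h : T -> \bar R) : (forall x, 0 <= h x) ->
    (forall x, h x <= `|f x|%:E) ->
    exists2 r, \int[mu]_x h x = r%:E & (0 <= r <= I)%R.
  move=> h0 hf.
  have hI : \int[mu]_x h x <= I%:E.
    by apply: le_trans gI; apply: ge0_le_integral_any => // x; exact: le_trans (fg x).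
  have : 0 <= \int[mu]_x h x by exact: integral_ge0.
  case: (\int[mu]_x h x) hI => [r| |] //.
  by rewrite !lee_fin => rI r0; exists r => //; rewrite r0.
have pos_le x : (EFin \o f)^\+ x <= `|f x|%:E.
  by rewrite funeposE ge_max !lee_fin ler_norm normr_ge0.
have neg_le x : (EFin \o f)^\- x <= `|f x|%:E.
  by rewrite funenegE ge_max -EFinN !lee_fin -normrN ler_norm normr_ge0.
have [a -> /andP[a0 aI]] := bnd _ (funepos_ge0 _) pos_le.
have [b -> /andP[b0 bI]] := bnd _ (funeneg_ge0 _) neg_le.
rewrite /= ler_norml; lra.
Qed.

End IntegralBounds.

Section TailIntegral.
Variables (p : nat) (p_pr : prime p) (R : realType) (n : nat).
Local Notation Qpn := 'rV[Qp p_pr]_n.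
Local Notation norm := (@Qpn_norm p p_pr R n).
Variable mu : {measure set (borelQpn p_pr n) -> \bar R}.
Hypothesis haar_mu : is_haar mu.

(** A sum of multiples of indicators of concentric balls dominates a power of the
    norm; its integral is at most a geometric series of ratio [theta * p ^ n]. *)
Lemma integral_cball_series_le (D theta : R) :
  0 <= D -> 0 <= theta -> theta * p%:R ^+ n < 1 ->
  (\int[mu]_y \sum_(k <oo)
     (D * theta ^+ k * \1_(Qpn_cball (0 : Qpn) (p%:R ^+ k : R)) y)%:E
   <= (D / (1 - theta * p%:R ^+ n))%:E)%E.
Proof.
move=> D0 t0 t1.
have pk1 k : 1 <= p%:R ^+ k :> R by rewrite exprn_ege1 // ler1n prime_gt0.
have mB k := measurable_Qpn_cball (0 : Qpn) (pk1 k).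
have c0 k : 0 <= D * theta ^+ k by rewrite mulr_ge0 // exprn_ge0.
rewrite integral_nneseries //; last 2 first.
- move=> k; apply/measurable_EFinP; apply: measurable_funM => //.
- by move=> k y _; rewrite lee_fin mulr_ge0 // indicE.
have rho0 : 0 <= theta * p%:R ^+ n by rewrite mulr_ge0 // exprn_ge0.
apply: (@le_trans _ _ (\sum_(k <oo) (geometric D (theta * p%:R ^+ n) k)%:E)%E).
  apply: lee_nneseries => [k _ _|k _].
    by apply: integral_ge0 => y _; rewrite lee_fin mulr_ge0 // indicE.
  under eq_integral do rewrite EFinM.
  rewrite ge0_integralZl ?lee_fin //.
    rewrite integral_indic // setIT.
    apply: le_trans (lee_wpmul2l _ (haar_cball_le haar_mu k)) _.
      by rewrite lee_fin.
    by rewrite -EFinM lee_fin /geometric /= exprMn mulrA -exprM mulnC.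
  by apply/measurable_EFinP; exact: measurable_indic.
apply: lime_le.
  by apply: is_cvg_nneseries => k _ _; rewrite lee_fin mulr_ge0 // exprn_ge0.
apply: nearW => m; rewrite sumEFin lee_fin.
rewrite -[leLHS]/(series (geometric D (theta * p%:R ^+ n)) m).
rewrite geometric_seriesE ?lt_eqF //= ler_wpM2r //.
  by rewrite invr_ge0 subr_ge0 ltW.
by rewrite ler_piMr // lerBlDr lerDl exprn_ge0.
Qed.

(** With [theta = p ^ (- s)] the ratio [theta * p ^ n] is less than 1 exactly when
    [n < s]. On the shell [p ^ (k - 1) < norm y <= p ^ k] the power
    [norm y ^ (- s)] is at most [theta ^ (k - 1)], and the term of index [k] in
    the series pays for it. *)
Lemma norm_Rintegral_tail_le (s : R) (l : int) : n%:R < s ->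
  exists2 I, 0 <= I & forall (f : Qpn -> R) c, 0 <= c ->
    (forall y, norm y <= p%:R ^ l -> f y = 0) ->
    (forall y, p%:R ^ l < norm y -> `|f y| <= c * norm y `^ (- s)) ->
    `|Rintegral mu setT (f : borelQpn p_pr n -> R)| <= c * I.
Proof.
move=> ns; have p1 : 1 < p%:R :> R by rewrite ltr1n prime_gt1.
have p0 : 0 < p%:R :> R by exact: lt_trans p1.
have s0 : 0 <= s by rewrite ltW // (le_lt_trans _ ns).
pose theta : R := p%:R `^ (- s).
have t0 : 0 < theta by exact: powR_gt0.
have t1 : theta * p%:R ^+ n < 1.
  rewrite -powR_mulrn ?ltW // -powRD; last by apply/implyP => _; rewrite gt_eqF.
  by rewrite /powR gt_eqF // expR_lt1 pmulr_llt0 ?ln_gt0 // addrC subr_lt0.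
pose pl : R := p%:R ^ l; have pl0 : 0 < pl by exact: exprz_gt0.
(* The first summand of [D] pays for [pl < norm y <= 1] in the term of index 0,
   the second shifts [theta ^+ k] to [theta ^+ k.-1] in the other terms. *)
pose D : R := pl `^ (- s) + theta^-1.
have D0 : 0 <= D by rewrite addr_ge0 ?powR_ge0 ?invr_ge0 // ltW.
have anti (a b : R) : 0 < a -> a <= b -> b `^ (- s) <= a `^ (- s).
  move=> a0 ab; have b0 := lt_le_trans a0 ab.
  rewrite !powRN lef_pV2 ?posrE ?powR_gt0 //.
  by rewrite ge0_ler_powR // nnegrE ltW.
have thetaX j : (p%:R ^+ j) `^ (- s) = theta ^+ j.
  rewrite -(powR_mulrn j (ltW p0)) -powRrM mulrC powRrM.
  by rewrite powR_mulrn // powR_ge0.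
exists (D / (1 - theta * p%:R ^+ n)).
  by rewrite divr_ge0 // subr_ge0 ltW.
move=> f c c0 fin fout; rewrite mulrA.
apply: norm_Rintegral_le; last first.
  by apply: (@integral_cball_series_le (c * D) theta); rewrite ?mulr_ge0 // ltW.
move=> y.
have term0 k : 0 <= c * D * theta ^+ k * \1_(Qpn_cball (0 : Qpn) (p%:R ^+ k : R)) y.
  by rewrite !mulr_ge0 ?exprn_ge0 ?indicE // ltW.
suff [k fk] : exists k, `|f y| <=
    c * D * theta ^+ k * \1_(Qpn_cball (0 : Qpn) (p%:R ^+ k : R)) y.
  apply: le_trans (nneseries_lim_ge k.+1 _); last by move=> j _ _; rewrite lee_fin.
  rewrite sumEFin lee_fin big_nat_recr //=; apply: (le_trans fk).
  by rewrite lerDr sumr_ge0.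
have [yl|yl] := leP (norm y) pl.
  by exists 0%N; rewrite fin // normr0.
have ex : exists k, norm y <= p%:R ^+ k.
  exists (Num.bound (norm y)); rewrite ltW //.
  apply: lt_le_trans (archi_boundP (Qpn_norm_ge0 _ _)) _.
  by rewrite -natrX ler_nat ltnW // ltn_expl // prime_gt1.
case: (ex_minnP ex) => k yk kmin; exists k.
rewrite indicE mem_set ?mulr1; last by rewrite /Qpn_cball /= subr0.
apply: le_trans (fout y yl) _; rewrite -mulrA ler_wpM2l //.
case: k yk kmin => [|k] yk kmin.
  rewrite mulr1; apply: le_trans (anti _ _ pl0 (ltW yl)) _.
  by rewrite lerDl invr_ge0 ltW.
have yk' : p%:R ^+ k <= norm y.
  by rewrite ltW // ltNge; apply/negP => /kmin; rewrite ltnn.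
apply: le_trans (anti _ _ _ yk') _; first by rewrite exprn_gt0.
rewrite thetaX exprS mulrA ler_peMl ?exprn_ge0 ?(ltW t0) //.
by rewrite mulrDl mulVf ?gt_eqF // lerDr mulr_ge0 ?powR_ge0 // ltW.
Qed.

End TailIntegral.

(** * Boundedness of the operators on functions with a fixed radius of constancy *)

Section OperatorBound.
Variables (p : nat) (p_pr : prime p) (R : realType) (n : nat).
Local Notation Qpn := 'rV[Qp p_pr]_n.
Local Notation norm := (@Qpn_norm p p_pr R n).
Variable mu : {measure set (borelQpn p_pr n) -> \bar R}.
Hypothesis haar_mu : is_haar mu.

(** The part of the bound that does not carry a factor [b] is absorbed into it
    through [1 <= b / delta], so that all of it decays like the tail of the kernel
    times [b]. Here [a], [b], [c] stand for the
    [lam]-th powers of the norms of [x], [y], [x - y]. *)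
Lemma growth_diff_le (A a b c delta u v : R) : 0 <= A -> 0 <= a -> 0 < delta ->
  delta <= b -> c <= a + b -> `|u| <= A * (1 + c) -> `|v| <= A * (1 + a) ->
  `|u - v| <= A * (1 + a) * (2 / delta + 1) * b.
Proof.
move=> A0 a0 d0 db cab uc va; set G := A * (1 + a).
have b0 : 0 <= b by apply: le_trans db; exact: ltW.
have G0 : 0 <= G by apply: mulr_ge0 => //; apply: addr_ge0.
have Ac : A * (1 + c) <= G + A * b.
  by rewrite /G -mulrDr ler_wpM2l // -addrA lerD2l.
have AG : A * b <= G * b by rewrite ler_wpM2r // /G ler_peMr // lerDl.
have Gd : G <= G / delta * b.
  by rewrite mulrAC -mulrA ler_peMr // ler_pdivlMr ?mul1r.
have -> : G * (2 / delta + 1) * b = G / delta * b * 2 + G * b by ring.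
have := ler_normB u v; rewrite -/G in va; lra.
Qed.

Definition real_opW (w phi : Qpn -> R) (x : Qpn) : R :=
  Rintegral mu setT (fun y : borelQpn p_pr n => (phi (x - y) - phi x) / w y).

Lemma Qpn_norm_powR_sub (lam : R) (x y : Qpn) : 0 <= lam ->
  norm (x - y) `^ lam <= norm x `^ lam + norm y `^ lam.
Proof.
move=> lam0; have := Qpn_normD R x (- y); rewrite Qpn_normN => h.
apply: (@le_trans _ _ (Num.max (norm x) (norm y) `^ lam)).
  by apply: (ge0_ler_powR lam0 _ _ h); rewrite nnegrE ?le_max Qpn_norm_ge0.
move: (norm x) (norm y) => a b; have a0 := powR_ge0 a lam.
by have b0 := powR_ge0 b lam; case: (leP a b) => _; lra.
Qed.

(** The integrand vanishes for [norm y <= p ^ l], and beyond that radius it is at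
    most a multiple of [A * (1 + norm x ^ lam) * norm y ^ (lam - gamma)]. *)
Lemma real_opW_bounded (gamma lam : R) (w : Qpn -> R) (l : int) :
  is_weight gamma w -> 0 <= lam -> lam < gamma - n%:R ->
  exists2 K, 0 <= K & forall (phi : Qpn -> R) A,
    (forall x x', norm x' <= p%:R ^ l -> phi (x + x') = phi x) ->
    (forall x, `|phi x| <= A * (1 + norm x `^ lam)) ->
    forall x, `|real_opW w phi x| <= K * (A * (1 + norm x `^ lam)).
Proof.
move=> ww lam0 lamg; have p0 : 0 < p%:R :> R by rewrite ltr0n prime_gt0.
have pl0 : 0 < p%:R ^ l :> R by exact: exprz_gt0.
have [C0 [C1 [C00 _ wC]]] := weight_bounds ww.
have [I I0 tail] := @norm_Rintegral_tail_le _ p_pr R n mu haar_mu (gamma - lam) l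
  (ltac:(lra)).
pose delta : R := (p%:R ^ l) `^ lam; have d0 : 0 < delta by exact: powR_gt0.
pose E := (2 / delta + 1) / C0.
have E0 : 0 <= E by rewrite divr_ge0 ?addr_ge0 ?divr_ge0 // ltW.
exists (E * I); first exact: mulr_ge0.
move=> phi A loc gro x; set G := A * (1 + norm x `^ lam).
have G0 : 0 <= G by exact: le_trans (gro x).
have A0 : 0 <= A.
  by move: G0; rewrite /G pmulr_lge0 // ltr_pwDl ?powR_ge0.
rewrite mulrAC [E * G]mulrC; apply: tail; first exact: mulr_ge0.
  by move=> y yl; rewrite loc ?Qpn_normN // subrr mul0r.
move=> y yl; have y0 : 0 < norm y by exact: lt_trans yl.
have dy : delta <= norm y `^ lam.
  by apply: ge0_ler_powR => //; rewrite ?nnegrE ltW.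
have num : `|phi (x - y) - phi x| <= G * (2 / delta + 1) * norm y `^ lam.
  exact: (growth_diff_le A0 (powR_ge0 _ _) d0 dy (Qpn_norm_powR_sub x y lam0)
    (gro _) (gro _)).
have wy : C0 * norm y `^ gamma <= w y by have /andP[] := wC y.
have g0 : 0 < norm y `^ gamma by exact: powR_gt0.
have w0 : 0 < w y by apply: lt_le_trans wy; exact: mulr_gt0.
rewrite normrM normfV (gtr0_norm w0) ler_pdivrMr //.
apply: (le_trans num).
have -> : G * (2 / delta + 1) * norm y `^ lam =
    G * E * norm y `^ (- (gamma - lam)) * (C0 * norm y `^ gamma).
  have -> : norm y `^ lam = norm y `^ (- (gamma - lam)) * norm y `^ gamma.
    rewrite -powRD; last by apply/implyP => _; rewrite gt_eqF.
    by congr (_ `^ _); ring.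
  by rewrite /E; field; rewrite !gt_eqF.
by rewrite ler_wpM2l // mulr_ge0 ?powR_ge0 // mulr_ge0.
Qed.

End OperatorBound.

(** * A Gronwall lemma in a weighted sup norm *)

Section WeightedGronwall.
Variable R : realType.

(** [A / 2 * exp (2 K s)] has derivative [K * A * exp (2 K s)], so [v] and [- v]
    minus this function are nonincreasing, and they are nonpositive at 0. *)
Lemma exp_bound_halves (v dv : R -> R) (T K A : R) : 0 <= A ->
  v 0 = 0 -> {within `[0, T], continuous v} ->
  (forall s, 0 < s < T -> is_derive s 1 v (dv s)) ->
  (forall s, 0 < s < T -> `|dv s| <= K * (A * expR (2 * K * s))) ->
  forall t, 0 <= t <= T -> `|v t| <= A / 2 * expR (2 * K * t).
Proof.
move=> A0; pose e s := A / 2 * expR (2 * K * s).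
have de (s : R) : is_derive s 1 e (A / 2 * (2 * K * expR (2 * K * s))).
  by rewrite /e; apply: is_derive_eq; rewrite /GRing.scale /=; ring.
have ce (B : set R) : {within B, continuous e}.
  apply: continuous_subspaceT => s; apply: differentiable_continuous.
  by apply/derivable1_diffP; exact: ex_derive.
have oneside (f df : R -> R) : f 0 = 0 -> {within `[0, T], continuous f} ->
    (forall s, 0 < s < T -> is_derive s 1 f (df s)) ->
    (forall s, 0 < s < T -> df s <= K * (A * expR (2 * K * s))) ->
    forall t, 0 <= t <= T -> f t <= e t.
  move=> f0 cf Df dfle t /andP[t0 tT].
  have DF (s : R) : s \in `]0, T[%R -> is_derive s 1 (f - e)
      (df s - A / 2 * (2 * K * expR (2 * K * s))).
    by rewrite in_itv /= => sT; have := Df s sT => ?; exact: is_deriveB.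
  have := @ler0_derive1_nincr _ (f - e) 0 T.
  move=> /(_ _ _ _ 0 t (lexx 0) t0 tT) h.
  have : (f - e) t <= (f - e) 0.
    apply: h => [s sT|s sT|].
    - by have := DF s sT => ?; exact: ex_derive.
    - have := DF s sT => ?; rewrite derive1E derive_val.
      move: sT; rewrite in_itv /= => /dfle.
      have -> : A / 2 * (2 * K * expR (2 * K * s)) = K * (A * expR (2 * K * s)).
        by field.
      lra.
    - move=> s; apply: cvgB; [exact: cf|exact: ce].
  rewrite /= -![(f - e) _]/(f _ - e _) f0 {2}/e mulr0 expR0 mulr1.
  lra.
move=> v0 cv Dv dvle t tT; rewrite ler_norml lerNl; apply/andP; split.
  apply: (oneside (- v) (fun s => - dv s)) => //.
  - by rewrite -[LHS]/(- v 0) v0 oppr0.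
  - by move=> s; apply: cvgN; exact: cv.
  - by move=> s /Dv ?; exact: is_deriveN.
  - by move=> s /dvle; rewrite ler_norml => /andP[]; lra.
by apply: (oneside v dv) => // s /dvle; exact: le_trans (ler_norm _).
Qed.

(** The time derivative at [x] is controlled by the values of [v] at all points,
    so the bounds are propagated uniformly in [x], relative to the weight [g]. *)
Lemma weighted_gronwall (X : Type) (g : X -> R) (v dv : X -> R -> R) (T K C : R) :
  (forall x, 0 <= g x) -> 0 <= C ->
  (forall x t, 0 <= t <= T -> `|v x t| <= C * g x) ->
  (forall x, v x 0 = 0) ->
  (forall x, {within `[0, T], continuous (v x)}) ->
  (forall x t, 0 < t < T -> is_derive t 1 (v x) (dv x t)) ->
  (forall A t, 0 < t < T -> (forall x, `|v x t| <= A * g x) ->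
     forall x, `|dv x t| <= K * (A * g x)) ->
  0 <= K ->
  forall x t, 0 <= t <= T -> v x t = 0.
Proof.
move=> g0 C0 vC v0 cv Dv dvK K0.
have bound m x t : 0 <= t <= T ->
    `|v x t| <= C / 2 ^+ m * g x * expR (2 * K * t).
  elim: m x t => [|m IHm] x t tT.
    rewrite expr0 invr1 mulr1; apply: le_trans (vC x t tT) _.
    rewrite ler_peMr ?mulr_ge0 // -expR0 ler_expR.
    by case/andP: tT => t0 _; rewrite !mulr_ge0.
  have -> : C / 2 ^+ m.+1 * g x = (C / 2 ^+ m * g x) / 2.
    by rewrite exprS; field; rewrite expf_neq0.
  apply: (@exp_bound_halves (v x) (dv x) T) => //.
  - by rewrite mulr_ge0 // divr_ge0 // exprn_ge0.
  - move=> s sT; rewrite [X in K * X]mulrAC; apply: dvK => // y.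
    rewrite mulrAC; apply: IHm.
    by case/andP: sT => s0 sT; rewrite !ltW.
move=> x t tT; apply/eqP; rewrite -normr_le0.
pose a : R := C * g x * expR (2 * K * t).
have : geometric a 2^-1 @ \oo --> (0 : R).
  by apply: cvg_geometric; rewrite ger0_norm ?invr_ge0 // invf_lt1 // ltr1n.
move/(@cvgr_to_ge _ _ _ _ _ _ _); apply; apply: nearW => m.
apply: le_trans (bound m x t tT) _; rewrite /geometric /= /a exprVn.
by rewrite (mulrAC C) (mulrAC (C * g x)).
Qed.

End WeightedGronwall.

(** * Real and imaginary parts of a solution *)

Section RealComponents.
Local Open Scope complex_scope.
Variable R : realType.

(** The properties of [Re] and [Im] on which the uniqueness argument rests, so
    that it is carried out once for both. *)
Record real_component (part : R[i] -> R) : Prop := {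
  part_add : forall z z', part (z + z') = part z + part z';
  part_scale : forall (r : R) z, part (r%:C * z) = r * part z;
  part_le_norm : forall z, `|part z|%:C <= `|z|;
  part_cintegral : forall p (p_pr : prime p) n
    (mu : {measure set (borelQpn p_pr n) -> \bar R}) f,
    part (cintegral mu f) = Rintegral mu setT (part \o f) }.

Lemma Re_real_component : real_component (@complex.Re R).
Proof.
by split=> [[a b] [c d]|r [a b]|z|] //=; [rewrite mul0r subr0|exact: normc_ge_Re].
Qed.

Lemma Im_real_component : real_component (@complex.Im R).
Proof.
split=> [[a b] [c d]|r [a b]|z|] //=; first by rewrite mul0r addr0.
have := normc_ge_Re (z * 'i); rewrite ReiNIm normrN normrM.
suff -> : `|'i : R[i]| = 1 by rewrite mulr1.
by rewrite normc_def /= expr0n expr1n add0r sqrtr1.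
Qed.

Variables (part : R[i] -> R) (hpart : real_component part).

Lemma part0 : part 0 = 0.
Proof. by rewrite -(mul0r 0) (part_scale hpart 0) mul0r. Qed.

Lemma partN z : part (- z) = - part z.
Proof. by rewrite -mulN1r -(rmorphN1 (real_complex R)) part_scale // mulN1r. Qed.

Lemma partB z z' : part (z - z') = part z - part z'.
Proof. by rewrite part_add // partN. Qed.

Lemma part_div z (r : R) : part (z / r%:C) = part z / r.
Proof. by rewrite mulrC -fmorphV part_scale // mulrC. Qed.

Lemma part_sum I (r : seq I) (F : I -> R[i]) :
  part (\sum_(i <- r) F i) = \sum_(i <- r) part (F i).
Proof. by apply: big_morph; [exact: part_add|exact: part0]. Qed.

Lemma part_le z (c : R) : `|z| <= c%:C -> `|part z| <= c.
Proof. by move=> zc; rewrite -lecR; exact: le_trans (part_le_norm hpart z) zc. Qed.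

Lemma part_continuous : continuous (part : R[i]^o -> R).
Proof.
move=> z; have nbhs_z : Filter (nbhs (z : R[i]^o)) by exact: nbhs_filter.
apply/(@cvgrPdist_lt _ _ _ (nbhs (z : R[i]^o)) nbhs_z) => e e0.
apply/nbhs_ballP; exists e%:C => [|y]; first by rewrite /= ltcR.
rewrite -ball_normE /= => zy.
by rewrite -partB -ltcR; exact: le_lt_trans (part_le_norm hpart _) zy.
Qed.

(** The derivative along the closed interval is one-sided only at its endpoints;
    at an interior time nearby times lie in the interval. *)
Lemma part_is_derive (T : R) (f : R -> R[i]) t d : 0 < t < T ->
  has_tderiv T f t d -> is_derive t 1 (part \o f) (part d).
Proof.
move=> /andP[t0 tT] fd.
suff h : h^-1 *: (((part \o f) \o shift t) (h *: 1) - (part \o f) t)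
    @[h --> 0^'] --> part d.
  by apply: DeriveDef; [apply/cvg_ex; exists (part d)|exact: cvg_lim h].
have {}fd : (part (f s) - part (f t)) / (s - t) @[s --> within `[0, T] t^']
    --> part d.
  have -> : (fun s => (part (f s) - part (f t)) / (s - t)) =
      part \o (fun s => (f s - f t) / (s - t)%:C).
    by apply/funext => s /=; rewrite part_div partB.
  exact: (cvg_comp _ _ fd (@part_continuous d)).
apply/cvgrPdist_lt => e e0.
have : \forall s \near t, s \in `]0, T[%R by apply: near_in_itvoo; rewrite in_itv /= t0.
move/cvgrPdist_lt: fd => /(_ e e0) /nbhs_ballP[d1 d10 near1].
move=> /nbhs_ballP[d2 d20 near2].
exists (Num.min d1 d2) => /=; first by rewrite lt_min d10.
move=> k /= kd k0; rewrite /GRing.scale /= mulr1.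
move: kd; rewrite sub0r normrN lt_min => /andP[kd1 kd2].
have kt r : `|k| < r -> ball t r (k + t).
  by move=> kr; rewrite -ball_normE /= opprD addrA addrAC subrr sub0r normrN.
have := near1 (k + t) (kt _ kd1).
rewrite addrK [k^-1 * _]mulrC; apply.
  by rewrite -subr_eq0 addrK.
have := near2 _ (kt _ kd2); rewrite /= in_itv /= => /andP[kt0 ktT].
by rewrite /= in_itv /= !ltW.
Qed.

End RealComponents.

Section Uniqueness.
Local Open Scope complex_scope.
Variables (R : realType) (p : nat) (p_pr : prime p) (n : nat).
Local Notation Qpn := 'rV[Qp p_pr]_n.
Local Notation norm := (@Qpn_norm p p_pr R n).

Lemma within_slice (V : topologicalType) (T : R) (f : Qpn -> R -> V) (x : Qpn) :
  continuous_on_strip T f -> {within `[0, T], continuous (f x)}.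
Proof.
move=> /subspace_continuousP cf; apply/subspace_continuousP => t tT.
have := cf (x, t) (conj I tT) => {}cf P /cf.
move=> [[/= A B] [Ax Bt] AB]; apply: filterS Bt => s Bs sT.
by apply: (AB (x, s)); split=> //; exact: nbhs_singleton Ax.
Qed.

Lemma part_opW (part : R[i] -> R) (mu : {measure set (borelQpn p_pr n) -> \bar R})
    (w : Qpn -> R) (phi : Qpn -> R[i]) x : real_component part ->
  part (opW mu w phi x) = real_opW mu w (part \o phi) x.
Proof.
move=> hpart; rewrite /opW part_cintegral //; congr (Rintegral _ _ _).
by apply/funext => y /=; rewrite part_div // partB.
Qed.

(** The constant of the Gronwall lemma is obtained by adding the bounds of the
    terms of the equation. In the term of index [k] the operator is bounded since
    [al 1] is the smallest exponent and [lam < al 1 - n], unless [a k] vanishes. *)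
Lemma part_solution_eq0 (part : R[i] -> R) (hpart : real_component part)
  (mu : {measure set (borelQpn p_pr n) -> \bar R}) (haar_mu : is_haar mu)
  (N : nat) (alpha : R) (al : nat -> R) (lam T : R)
  (w : R -> Qpn -> R) (a : nat -> Qpn -> R -> R) (b : Qpn -> R -> R)
  (al_lt : forall k, (1 <= k <= N)%N -> al k < alpha)
  (al_incr : forall j k, (1 <= j < k)%N -> (k <= N)%N -> al j < al k)
  (w_alpha : is_weight alpha (w alpha))
  (w_al : forall k, (1 <= k <= N)%N -> is_weight (al k) (w (al k)))
  (a_bounded : forall k, (k <= N)%N -> bounded_on_strip T (a k))
  (b_bounded : bounded_on_strip T b)
  (lam_ge0 : 0 <= lam)
  (lam_lt : ((1 <= N)%N /\ lam < al 1%N - n%:R) \/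
    ((forall k x t, (1 <= k <= N)%N -> 0 <= t <= T -> a k x t = 0) /\
     lam < alpha - n%:R))
  (u : Qpn -> R -> R[i])
  (sol_u : homogeneous_solution mu w N alpha al a b lam T u) :
  forall x t, 0 <= t <= T -> part (u x t) = 0.
Proof.
have [C [l uCl]] := sol_classM_unif sol_u.
have [du [_ Du equ]] := sol_equation sol_u.
pose g (x : Qpn) : R := 1 + norm x `^ lam.
have g0 x : 0 <= g x by rewrite addr_ge0 // powR_ge0.
pose term k x t := if k == 0%N
  then a 0%N x t * real_opW mu (w alpha) (part \o u^~ t) x
  else a k x t * real_opW mu (w (al k)) (part \o u^~ t) x.
have lam_alpha : lam < alpha - n%:R.
  case: lam_lt => [[N1 l1]|[_ //]]; apply: lt_trans l1 _.
  by rewrite ltrD2r; apply: al_lt.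
have tTW t : 0 < t < T -> 0 <= t <= T by case/andP=> *; rewrite !ltW.
have weighted gamma k : (k <= N)%N -> is_weight gamma (w gamma) ->
    lam < gamma - n%:R ->
    exists2 K, 0 <= K & forall A t, 0 < t < T ->
      (forall x, `|part (u x t)| <= A * g x) ->
      forall x, `|a k x t * real_opW mu (w gamma) (part \o u^~ t) x| <= K * (A * g x).
  move=> kN wg lg; have [K K0 KW] := real_opW_bounded haar_mu l wg lam_ge0 lg.
  have [M aM] := a_bounded _ kN.
  exists (`|M| * K) => [|A t tT uA x]; first exact: mulr_ge0.
  rewrite normrM -mulrA ler_pM //.
    by apply: le_trans (ler_norm M); exact/aM/tTW.
  apply: KW => // y y' y'l /=; congr part.
  by have [loc _] := uCl _ (tTW _ tT); exact: loc.
have term_bound k : (k <= N)%N -> exists2 K, 0 <= K & forall A t, 0 < t < T ->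
    (forall x, `|part (u x t)| <= A * g x) ->
    forall x, `|term k x t| <= K * (A * g x).
  move=> kN; rewrite /term; case: eqVneq => [_|k0]; first exact: weighted.
  have k1 : (1 <= k <= N)%N by rewrite lt0n k0.
  case: lam_lt => [[N1 l1]|[ak0 _]].
    apply: weighted => //; first exact: w_al.
    apply: (lt_le_trans l1); rewrite lerD2r.
    have [->|k1'] := eqVneq k 1%N; first exact: lexx.
    by rewrite ltW // al_incr //= ltn_neqAle eq_sym k1' lt0n.
  exists 0 => // A t tT _ x.
  by rewrite ak0 ?tTW // mul0r normr0 mul0r.
have sum_bound m : (m <= N.+1)%N -> exists2 K, 0 <= K & forall A t, 0 < t < T ->
    (forall x, `|part (u x t)| <= A * g x) ->
    forall x, `|\sum_(0 <= k < m) term k x t| <= K * (A * g x).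
  elim: m => [_|m IHm mN].
    by exists 0 => // A t _ _ x; rewrite big_nil normr0 mul0r.
  have [K1 K10 h1] := IHm (ltnW mN); have [K2 K20 h2] := term_bound _ mN.
  exists (K1 + K2) => [|A t tT uA x]; first exact: addr_ge0.
  rewrite big_nat_recr //= mulrDl; apply: le_trans (ler_normD _ _) _.
  by apply: lerD; [exact: h1|exact: h2].
have [K1 K10 hK1] := sum_bound _ (leqnn _).
have [M bM] := b_bounded.
have dE x t : 0 < t < T ->
    part (du x t) = \sum_(0 <= k < N.+1) term k x t - b x t * part (u x t).
  move=> tT; have tT' : 0 < t <= T by case/andP: tT => -> /ltW.
  have /(congr1 part) := equ x t tT'.
  rewrite part0 // part_add // !partB // !part_scale // part_sum //.
  rewrite part_opW // [\sum_(0 <= k < N.+1) _]big_nat_recl //= {1}/term /=.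
  have -> : \sum_(1 <= k < N.+1) part ((a k x t)%:C * opW mu (w (al k)) (u^~ t) x)
      = \sum_(0 <= k < N) term k.+1 x t.
    rewrite big_add1 /=; apply: eq_bigr => k _.
    by rewrite part_scale // part_opW.
  lra.
apply: (@weighted_gronwall R Qpn g (fun x t => part (u x t))
    (fun x t => part (du x t)) T (K1 + `|M|) `|C|) => //.
- move=> x t tT; have [_ gro] := uCl t tT.
  apply: part_le => //; apply: le_trans (gro x) _.
  by rewrite lecR; apply: ler_wpM2r; [exact: g0|exact: ler_norm].
- by move=> x; rewrite (sol_initial sol_u) part0.
- move=> x; have /subspace_continuousP cu :=
    @within_slice R[i]^o T u x (sol_continuous sol_u).
  apply/subspace_continuousP => s sT.
  exact: (cvg_comp _ _ (cu s sT) (@part_continuous _ _ hpart _)).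
- move=> x t tT; apply: part_is_derive (tT) (Du x t _) => //.
  by case/andP: tT => -> /ltW.
- move=> A t tT uA x; rewrite dE // mulrDl; apply: le_trans (ler_normB _ _) _.
  apply: lerD; first exact: hK1.
  rewrite normrM ler_pM //.
  by apply: le_trans (ler_norm M); exact/bM/tTW.
- exact: addr_ge0.
Qed.

End Uniqueness.

Theorem theorem6p3 (R : realType) (p : nat) (p_pr : prime p) (n : nat)
  (mu : {measure set (borelQpn p_pr n) -> \bar R}) (haar_mu : is_haar mu)
  (N : nat) (alpha : R) (al : nat -> R) (lam T : R)
  (w : R -> 'rV[Qp p_pr]_n -> R)
  (a : nat -> 'rV[Qp p_pr]_n -> R -> R) (b : 'rV[Qp p_pr]_n -> R -> R)
  (n_lt_alpha : n%:R < alpha)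
  (al_bounds : forall k, (1 <= k <= N)%N -> n%:R < al k < alpha)
  (al_incr : forall j k, (1 <= j < k)%N -> (k <= N)%N -> al j < al k)
  (T_gt0 : 0 < T)
  (w_alpha : is_weight alpha (w alpha))
  (w_al : forall k, (1 <= k <= N)%N -> is_weight (al k) (w (al k)))
  (a_ge0 : forall k x t, (k <= N)%N -> 0 <= t <= T -> 0 <= a k x t)
  (a_bounded : forall k, (k <= N)%N -> bounded_on_strip T (a k))
  (a_continuous : forall k, (k <= N)%N -> continuous_on_strip T (a k))
  (b_bounded : bounded_on_strip T b)
  (b_continuous : continuous_on_strip T b)
  (lam_ge0 : 0 <= lam)
  (lam_lt : ((1 <= N)%N /\ lam < al 1%N - n%:R) \/
    ((forall k x t, (1 <= k <= N)%N -> 0 <= t <= T -> a k x t = 0) /\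
     lam < alpha - n%:R))
  (u : 'rV[Qp p_pr]_n -> R -> R[i])
  (sol_u : homogeneous_solution mu w N alpha al a b lam T u) :
  forall x t, 0 <= t <= T -> u x t = 0.
Proof.
have al_lt k : (1 <= k <= N)%N -> al k < alpha by case/al_bounds/andP.
have parts0 (part : R[i] -> R) : real_component part ->
    forall x t, 0 <= t <= T -> part (u x t) = 0.
  by move=> hpart; exact: (part_solution_eq0 hpart haar_mu al_lt al_incr w_alpha
    w_al a_bounded b_bounded lam_ge0 lam_lt sol_u).
move=> x t tT.
have := parts0 _ (Re_real_component R) x t tT.
have := parts0 _ (Im_real_component R) x t tT.
by case: (u x t) => [r s] /= -> ->.
Qed.
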